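(* Algorithm 2 (described in the context) is a 4-approximation algorithm for min-sum 2-TSP: for every instance, the returned tours $C_b,C_r$ satisfy $c(C_b)+c(C_r)\le 4\cdot\mathrm{OPT}$, where $\mathrm{OPT}$ is the minimum of $c(R)+c(B)$ over all feasible solutions.
   Context: An instance of 2-TSP consists of $2n$ nodes $V$ (with $n$ even) partitioned into $n$ pairs $\{p_i,q_i\}$, with metric edge weights $c$ on the complete graph on $V$ (nonnegative, triangle inequality). A feasible solution colors one node of each pair red and the other blue, and consists of a tour (Hamiltonian cycle) $R$ on the red nodes and a tour $B$ on the blue nodes; the min-sum objective minimizes $c(R)+c(B)$, with $c(F)$ the total weight of edge set $F$. Algorithm 2: (1) compute a minimum spanning tree $T$ on all $2n$ nodes; (2) delete a maximum-weight edge $e_\times$ of $T$, obtaining trees $T_L,T_R$ on node sets $V_L,V_R$; (3) for each pair with one node in $V_L$ and the other in $V_R$, color the node in $V_L$ blue and the node in $V_R$ red; (4) for every other pair, assign its nodes arbitrary distinct colors; (5) compute a tour $C$ of all nodes from $T$ by edge-doubling (traverse an Eulerian circuit of $T$ with every edge doubled, shortcutting repeated nodes); (6) for each color $c\in\{b,r\}$, let $C_c$ be the tour of the color-$c$ nodes obtained by shortcutting $C$ (visiting the color-$c$ nodes in the order of $C$); return $\{C_b,C_r\}$. *)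

(* Defs.v *)
From mathcomp Require Import all_boot all_order all_algebra.

Set Implicit Arguments.
Unset Strict Implicit.
Unset Printing Implicit Defensive.

Import Order.TTheory GRing.Theory Num.Theory.
Local Open Scope ring_scope.

Section Graphs.
Variable V : finType.

(* Edges of the complete graph on V are the two-element sets of nodes, and a
   graph on V is given by its edge set. *)
Definition is_edge (e : {set V}) : bool := #|e| == 2%N.

Definition adj (F : {set {set V}}) : rel V := fun x y => [set x; y] \in F.

Definition connected_graph (F : {set {set V}}) : Prop :=
  forall x y, connect (adj F) x y.

Definition acyclic_graph (F : {set {set V}}) : Prop :=
  forall s : seq V, ucycle (adj F) s -> (size s < 3)%N.

Definition spanning_tree (T : {set {set V}}) : Prop :=
  [/\ {in T, forall e, is_edge e}, connected_graph T & acyclic_graph T].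

(* A closed walk is given by its cyclic sequence of nodes x_0, ..., x_(m-1);
   its edges, with multiplicity, are {x_i, x_(i+1 mod m)}. *)
Definition closed_walk_edges (s : seq V) : seq {set V} :=
  [seq [set xy.1; xy.2] | xy <- zip s (rot 1 s)].

(* A Hamiltonian cycle on the node set A. On two nodes it consists of the
   edge between them taken twice. *)
Definition tour_on (A : {set V}) (s : seq V) : Prop := uniq s /\ s =i A.

Definition doubled_euler_circuit (T : {set {set V}}) (w : seq V) : Prop :=
  perm_eq (closed_walk_edges w) (enum T ++ enum T).

(* Keeps the first visit of each node; [undup] alone keeps the last one. *)
Definition shortcut (w : seq V) : seq V := rev (undup (rev w)).

End Graphs.

Section TwoTSP.
Variables (R : realFieldType) (V : finType).

(* The weights c are only constrained, and only ever used, on edges. *)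
Definition metric (c : {set V} -> R) : Prop :=
  (forall e, is_edge e -> 0 <= c e) /\
  (forall x y z, x != y -> y != z -> x != z ->
     c [set x; z] <= c [set x; y] + c [set y; z]).

Definition tsp2_instance (n : nat) (P : {set {set V}}) (c : {set V} -> R) :
    Prop :=
  [/\ ~~ odd n, #|V| = (2 * n)%N,
      partition P [set: V] /\ #|P| = n,
      {in P, forall A : {set V}, #|A| = 2%N}
    & metric c].

Definition weight (c : {set V} -> R) (F : {set {set V}}) : R :=
  \sum_(e in F) c e.

Definition tour_weight (c : {set V} -> R) (s : seq V) : R :=
  \sum_(e <- closed_walk_edges s) c e.

(* A coloring is given by its set of red nodes; the other nodes are blue. *)
Definition proper_coloring (P : {set {set V}}) (red : {set V}) : Prop :=
  {in P, forall A, #|A :&: red| = 1%N /\ #|A :&: ~: red| = 1%N}.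

Definition feasible (P : {set {set V}}) (r b : seq V) : Prop :=
  exists red : {set V},
    [/\ proper_coloring P red, tour_on red r & tour_on (~: red) b].

Definition is_min_sum_opt (P : {set {set V}}) (c : {set V} -> R) (opt : R) :
    Prop :=
  (exists r b, feasible P r b /\ tour_weight c r + tour_weight c b = opt) /\
  (forall r b, feasible P r b -> opt <= tour_weight c r + tour_weight c b).

Definition min_spanning_tree (c : {set V} -> R) (T : {set {set V}}) : Prop :=
  spanning_tree T /\ (forall T', spanning_tree T' -> weight c T <= weight c T').

Definition max_weight_edge (c : {set V} -> R) (T : {set {set V}})
    (e : {set V}) : Prop :=
  e \in T /\ {in T, forall f, c f <= c e}.

Definition component (F : {set {set V}}) (x : V) : {set V} :=
  [set z | connect (adj F) x z].

(* The coloring stays arbitrary on the pairs that do not have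
   one node in each of VL and VR. *)
Definition coloring_respects (P : {set {set V}}) (VL VR red : {set V}) : Prop :=
  forall u v, [set u; v] \in P -> u \in VL -> v \in VR ->
    u \notin red /\ v \in red.

(* [algorithm2 P c Cb Cr] holds when some run of the algorithm returns the
   blue tour Cb and the red tour Cr. All the choices left open are arbitrary:
   the minimum spanning tree T, the maximum-weight edge {x, y} and which of
   its sides is called VL, the coloring, and the Eulerian circuit w. *)
Inductive algorithm2 (P : {set {set V}}) (c : {set V} -> R) :
    seq V -> seq V -> Prop :=
| Algorithm2_run (T : {set {set V}}) (x y : V) (red : {set V}) (w : seq V) :
    min_spanning_tree c T ->
    max_weight_edge c T [set x; y] ->
    proper_coloring P red ->
    coloring_respects P (component (T :\ [set x; y]) x)
                        (component (T :\ [set x; y]) y) red ->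
    doubled_euler_circuit T w ->
    algorithm2 P c [seq v <- shortcut w | v \notin red]
                   [seq v <- shortcut w | v \in red].

End TwoTSP.

(* Main.v *)
Require Import Defs.
From mathcomp Require Import all_boot all_order all_algebra.
From mathcomp Require Import lra.

Set Implicit Arguments.
Unset Strict Implicit.
Unset Printing Implicit Defensive.

Import Order.TTheory GRing.Theory Num.Theory.
Local Open Scope ring_scope.

(** Let e be the deleted edge, with sides VL and VR.  Shortcutting the doubled
    tree gives c(Cb) + c(Cr) <= 4 c(T).  If an optimal tour has an edge g
    between VL and VR, then c(g) >= c(e) by exchange; replacing g by any edge f
    of T between the two optimal color classes connects the graph, and
    c(f) <= c(e), so c(T) <= OPT.  Otherwise VL and VR are the optimal color
    classes, so the algorithm uses them too; collapsing either side to an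
    endpoint of e shows that Cb and Cr cost at most twice the weight of T - e,
    and the optimal tours plus e connect the graph, so c(T) - c(e) <= OPT. *)

(** * Connectivity in graphs given by edge sets *)

Section Graphs.
Variable V : finType.
Implicit Types (F T P : {set {set V}}) (A red : {set V}) (s p : seq V).

Lemma adj_sym F : symmetric (adj F).
Proof. by move=> x y; rewrite /adj setUC. Qed.

Lemma connect_adjC F x y : connect (adj F) x y = connect (adj F) y x.
Proof. exact: (sym_connect_sym (@adj_sym F)). Qed.

Lemma connected_graph_from F x :
  (forall y, connect (adj F) x y) -> connected_graph F.
Proof.
by move=> cx u v; apply: (connect_trans _ (cx v)); rewrite connect_adjC.
Qed.

Lemma connect_adjS F F' : F \subset F' ->
  subrel (connect (adj F)) (connect (adj F')).
Proof.
move=> /subsetP sF; apply: connect_sub => x y xy.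
by apply/connect1/sF.
Qed.

Lemma set2_eq (a b x y : V) : [set a; b] = [set x; y] ->
  (a = x /\ b = y) \/ (a = y /\ b = x).
Proof.
move=> E.
have /set2P ha : a \in [set x; y] by rewrite -E set21.
have /set2P hb : b \in [set x; y] by rewrite -E set22.
have /set2P hx : x \in [set a; b] by rewrite E set21.
have /set2P hy : y \in [set a; b] by rewrite E set22.
by case: ha => ?; case: hb => ?; case: hx => ?; case: hy => ?; subst; auto.
Qed.

Lemma is_edge_set2 (x y : V) : is_edge [set x; y] = (x != y).
Proof. by rewrite /is_edge cards2; case: (x != y). Qed.

(** * Redundant edges and spanning trees *)

Lemma connected_delete_edge F x y :
  connected_graph F -> connect (adj (F :\ [set x; y])) x y ->
  connected_graph (F :\ [set x; y]).
Proof.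
move=> cF cxy u v; move: (cF u v); apply: connect_sub => {u v} a b ab.
have [E|ne] := eqVneq [set a; b] [set x; y]; last first.
  by apply: connect1; rewrite /adj in_setD1 ne.
by case: (set2_eq E) => -[-> ->] //; rewrite connect_adjC.
Qed.

(** [[set a; b]] is a singleton when [a = b], so a set closing up a walk may contain loops; these
    never help to connect anything. *)
Lemma connected_edges F : connected_graph F ->
  connected_graph [set e in F | is_edge e].
Proof.
move=> cF u v; move: (cF u v); apply: connect_sub => {u v} a b ab.
have [->//|ne] := eqVneq a b; apply: connect1.
by rewrite /adj inE [_ \in F]ab is_edge_set2.
Qed.

Lemma path_avoids_vertex F a q x p :
  a \notin x :: p -> path (adj F) x p -> path (adj (F :\ [set a; q])) x p.
Proof.
elim: p x => //= y p IH x; rewrite !inE !negb_or => /and3P[ax ay ap].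
case/andP=> xy yp; rewrite IH ?inE ?negb_or ?ay // andbT /adj in_setD1.
rewrite [_ \in F]xy andbT; apply/eqP => E.
have : a \in [set x; y] by rewrite E set21.
by rewrite !inE (negPf ax) (negPf ay).
Qed.

(** The rest of the cycle leads from [b] back to [a]. Up to its last step it avoids [a], and that
    step comes from a node other than [b] since the cycle has at least three nodes. *)
Lemma cycle_edge_redundant F a b s :
  (0 < size s)%N -> ucycle (adj F) [:: a, b & s] ->
  connect (adj (F :\ [set a; b])) a b.
Proof.
move=> s0 /andP[/=]; rewrite rcons_path => /and3P[ab bs sa].
case/and3P=> nab nbs us; rewrite connect_adjC.
apply: (connect_trans (y := last b s)).
  by apply/connectP; exists s => //; apply: path_avoids_vertex.
apply: connect1; rewrite /adj in_setD1 [_ \in F]sa andbT.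
case: s s0 nab nbs {bs us sa} => //= z s _.
rewrite !inE !negb_or => /and3P[nab naz nas] /andP[nbz nbs].
apply/eqP => E; have : b \in [set last z s; a] by rewrite E set22.
have hl := mem_last z s.
case/set2P => Eb; last by rewrite Eb eqxx in nab.
by move: hl; rewrite -Eb inE (negPf nbz) (negPf nbs).
Qed.

(** Induction on the number of edges: delete an edge whose endpoints stay connected without it. When
    there is none, no cycle of length at least three is left. *)
Lemma connected_has_spanning_tree F :
  {in F, forall e, is_edge e} -> connected_graph F ->
  exists2 T, spanning_tree T & T \subset F.
Proof.
have [m] := ubnP #|F|; elim: m F => // m IH F; rewrite ltnS => Fm eF cF.
have [/existsP[a /existsP[b /andP[abF cab]]]|nored] := boolP
  [exists a, exists b, ([set a; b] \in F) &&
     connect (adj (F :\ [set a; b])) a b].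
  have [|e||T sT TF] := IH (F :\ [set a; b]).
  - by rewrite (leq_trans _ Fm) // [X in (_ < X)%N](cardsD1 [set a; b]) abF.
  - by case/setD1P=> _ /eF.
  - exact: connected_delete_edge.
  by exists T => //; apply: subset_trans TF (subsetDl _ _).
exists F => //; split=> // s us; rewrite ltnNge; apply: contra nored.
case: s us => [|a [|b s]] // us s3; apply/existsP; exists a.
apply/existsP; exists b; rewrite (cycle_edge_redundant _ us) // andbT.
by case/andP: us => /= /andP[].
Qed.

(** Otherwise [A] would be closed under adjacency, hence contain everything reachable from [u]. *)
Lemma edge_leaving T A u v : connected_graph T -> u \in A -> v \notin A ->
  exists a b, [/\ [set a; b] \in T, a \in A & b \notin A].
Proof.
move=> cT uA vA; have [/existsP[a /existsP[b /and3P[]]]|none] := boolP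
  [exists a, exists b, [&& [set a; b] \in T, a \in A & b \notin A]].
  by exists a, b.
have cl : closed (adj T) (mem A).
  apply: intro_closed; first exact: (sym_connect_sym (@adj_sym T)).
  move=> a b ab aA; apply: contraNT none => bA.
  by apply/existsP; exists a; apply/existsP; exists b; apply/and3P.
have := closed_connect cl (cT u v).
by rewrite uA (negPf vA).
Qed.

(** * Edges of open and closed walks *)

Definition path_edges x p : seq {set V} :=
  pairmap (fun u v => [set u; v]) x p.

Lemma closed_walk_edges_cons x p :
  closed_walk_edges (x :: p) = path_edges x (rcons p x).
Proof.
rewrite /closed_walk_edges rot1_cons; move: {2 4}x => y.
by elim: p x => [|z p IH] x //=; rewrite IH.
Qed.

Lemma path_edges_rcons x p y :
  path_edges x (rcons p y) = rcons (path_edges x p) [set last x p; y].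
Proof. by elim: p x => //= z p IH x; rewrite /path_edges /= -/(path_edges _ _) IH. Qed.

Lemma connect_path_edges F x p y :
  {subset path_edges x p <= F} -> y \in x :: p -> connect (adj F) x y.
Proof.
elim: p x => [|z p IH] x sF; first by rewrite inE => /eqP->.
rewrite inE => /predU1P[->//|yp].
apply: (connect_trans (y := z)); first by apply/connect1/sF/mem_head.
by apply: IH => // e ep; apply: sF; rewrite inE ep orbT.
Qed.

Lemma not_path_split (r : rel V) x p : ~~ path r x p ->
  exists p1 y p2, p = p1 ++ y :: p2 /\ ~~ r (last x p1) y.
Proof.
elim: p x => //= z p IH x; rewrite negb_and => /orP[nr|/IH].
  by exists [::], z, p.
by case=> p1 [y [p2 [-> ?]]]; exists (z :: p1), y, p2.
Qed.

(** Moves an edge that crosses the boundary of [A] to the closing position of the cyclic sequence,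
    so that deleting it leaves the path [a :: p]. *)
Lemma crossing_rotation A s u v : u \in s -> v \in s ->
  u \in A -> v \notin A ->
  exists k a p, rot k s = a :: p /\ (last a p \in A) != (a \in A).
Proof.
case: s => // x q us vs uA vA.
pose r : rel V := fun a b => (a \in A) == (b \in A).
(* Being on the same side of [A] is transitive, so without a crossing edge [u] and [v] would lie on
   the same side. *)
have np : ~~ path r x (rcons q x).
  have rt : transitive r by move=> a b d /eqP h /eqP h'; apply/eqP; rewrite h.
  apply: contraL uA; rewrite rcons_path => /andP[/(order_path_min rt)/allP h _].
  have hx z : z \in x :: q -> (z \in A) = (x \in A).
    by rewrite inE => /predU1P[->//|/h/eqP->].
  by rewrite (hx u us) -(hx v vs).
case/not_path_split: np => p1 [y [p2 [E nr]]].
case/lastP: p2 E => [|p2 z].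
  rewrite cats1 => /rcons_inj[E1 E2]; exists 0%N, x, q.
  by rewrite rot0; split=> //; rewrite E1 [in X in _ != X]E2.
rewrite -rcons_cons -rcons_cat => /rcons_inj[E1 E2].
exists (size (x :: p1)), y, (p2 ++ x :: p1).
by rewrite E1 -cat_cons rot_size_cat; split=> //; rewrite last_cat.
Qed.

(** * Shortcuts and doubled Eulerian circuits *)

Lemma subseq_shortcut s : subseq (shortcut s) s.
Proof. by rewrite -[X in subseq _ X]revK subseq_rev undup_subseq. Qed.

Lemma mem_shortcut s : shortcut s =i s.
Proof. by move=> x; rewrite mem_rev mem_undup mem_rev. Qed.

Lemma shortcut_uniq s : uniq (shortcut s).
Proof. by rewrite rev_uniq undup_uniq. Qed.

(** A second node [y] forces some edge of the connected graph [T] to be incident to [x], and the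
    circuit traverses that edge. *)
Lemma doubled_euler_circuit_covers T w x y :
  connected_graph T -> x != y -> doubled_euler_circuit T w -> x \in w.
Proof.
move=> cT xy Tw; have yx : y \notin [set x] by rewrite inE eq_sym.
have [a [b [abT /set1P ax _]]] := edge_leaving cT (set11 x) yx; subst a.
have : [set x; b] \in closed_walk_edges w.
  by rewrite (perm_mem Tw) mem_cat mem_enum abT.
case/mapP=> -[u v] /= uv E.
have /andP[uw vw] : (u \in w) && (v \in w).
  rewrite -[in X in _ && X](mem_rot 1) -{1}(unzip1_zip (s := w) (t := rot 1 w)).
    rewrite -[X in _ && (_ \in X)](unzip2_zip (s := w)) ?size_rot //.
    by apply/andP; split; apply/mapP; exists (u, v).
  by rewrite size_rot.
by have /set2P[->|->] : x \in [set u; v] by rewrite -E set21.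
Qed.

(** * The two sides of a deleted tree edge *)

Lemma tree_edge_separates T x y : spanning_tree T -> [set x; y] \in T ->
  y \notin component (T :\ [set x; y]) x.
Proof.
case=> eT _ aT xyT; rewrite inE; apply/negP => /connectP[p0 xp0 y0].
have nxy : x != y by rewrite -is_edge_set2 eT.
move: y0; case: (shortenP xp0) => p xp up _ yl.
(* A simple path from [x] to [y] has more than one step, since [x != y] and the edge between them is
   deleted; that edge closes the path to a forbidden cycle. *)
case: p xp up yl => [|a [|b p]] /=.
- by move=> _ _ yx; rewrite yx eqxx in nxy.
- by move=> h _ ya; move: h; rewrite -ya /adj in_setD1 eqxx.
move=> xp up yl; suff /aT : ucycle (adj T) [:: x, a, b & p] by [].
apply/andP; split=> //=; rewrite rcons_path -yl [adj T y x]adj_sym [adj T x y]xyT andbT.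
have sT u v : adj (T :\ [set x; y]) u v -> adj T u v by case/setD1P.
by case/and3P: xp => /sT-> /sT-> /(sub_path sT).
Qed.

(** The union of both components is closed under adjacency in [T], because the deleted edge only
    joins [x] and [y], which lie in it. *)
Lemma component_cover T x y z : connected_graph T ->
  z \notin component (T :\ [set x; y]) x -> z \in component (T :\ [set x; y]) y.
Proof.
set F := T :\ _ => cT zx.
pose A := component F x :|: component F y.
have cl : closed (adj T) (mem A).
  apply: intro_closed; first exact: (sym_connect_sym (@adj_sym T)).
  move=> a b ab; have [E _|ne] := eqVneq [set a; b] [set x; y].
    have /set2P[->|->] : b \in [set x; y] by rewrite -E set22.
      by rewrite !inE connect0.
    by rewrite !inE connect0 orbT.
  have abF : connect (adj F) a b by apply: connect1; rewrite /adj in_setD1 ne.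
  by rewrite !inE => /orP[] h; rewrite (connect_trans h abF) ?orbT.
have := closed_connect cl (cT x z).
by rewrite !inE connect0 -[connect _ x z]in_set (negPf zx) => /esym.
Qed.

End Graphs.

(** * Weights of walks under the triangle inequality *)

Section Weights.
Variables (R : realFieldType) (V : finType).
Implicit Types (F T P : {set {set V}}) (A red : {set V}) (s p : seq V).
Implicit Types (c d : {set V} -> R).

(** Unlike [metric], this also governs loops, so it survives pulling back along maps that identify
    nodes. Nonnegativity follows from the two clauses. *)
Definition semimetric d : Prop :=
  (forall x, d [set x] = 0) /\
  (forall x y z, d [set x; z] <= d [set x; y] + d [set y; z]).

Lemma semimetric_ge0 d x y : semimetric d -> 0 <= d [set x; y].
Proof.
case=> d0 dt; have := dt x y x; rewrite setUid d0 [[set y; x]]setUC.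
by lra.
Qed.

Lemma semimetric_imset d (f : V -> V) :
  semimetric d -> semimetric (fun e => d (f @: e)).
Proof.
case=> d0 dt; split=> [x|x y z]; first by rewrite imset_set1 d0.
by rewrite !imsetU !imset_set1.
Qed.

Definition path_weight d x p : R := \sum_(e <- path_edges x p) d e.

Lemma path_weight_cons d x y p :
  path_weight d x (y :: p) = d [set x; y] + path_weight d y p.
Proof. by rewrite /path_weight /path_edges /= big_cons. Qed.

Lemma path_weight_rcons d x p y :
  path_weight d x (rcons p y) = path_weight d x p + d [set last x p; y].
Proof. by rewrite /path_weight path_edges_rcons -cats1 big_cat big_seq1. Qed.

Lemma tour_weight_cons d x p :
  tour_weight d (x :: p) = path_weight d x (rcons p x).
Proof. by rewrite /tour_weight closed_walk_edges_cons. Qed.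

Lemma path_weight_ge0 d x p : semimetric d -> 0 <= path_weight d x p.
Proof.
move=> sd; elim: p x => [|y p IH] x; first by rewrite /path_weight big_nil.
by rewrite path_weight_cons addr_ge0 // semimetric_ge0.
Qed.

Lemma tour_weight_rot d k s : tour_weight d (rot k s) = tour_weight d s.
Proof.
elim: k => [|k IH]; first by rewrite rot0.
have [kn|kn] := ltnP k (size s); last by rewrite -IH !rot_oversize // leqW.
rewrite -add1n rotD ?add1n // -{}IH; case: (rot k s) => [|x [|y p]] //=.
rewrite rot1_cons rcons_cons !tour_weight_cons path_weight_rcons.
by rewrite rcons_cons path_weight_cons last_rcons addrC.
Qed.

(** With both ends fixed, each dropped inner node is bypassed by the triangle inequality. *)
Lemma path_weight_subseq d x p q y : semimetric d -> subseq p q ->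
  path_weight d x (rcons p y) <= path_weight d x (rcons q y).
Proof.
move=> sd; elim: q x p => [|z q IH] x p; first by move/eqP->.
case: p => [|a p] /=.
  move=> _; rewrite [leRHS]path_weight_cons.
  apply: (le_trans _ (lerD (lexx _) (IH z [::] (sub0seq _)))).
  by rewrite /= !path_weight_cons addrA lerD2r sd.2.
case: eqVneq => [<-|_] pq.
  by rewrite /= !path_weight_cons lerD2l IH.
rewrite [leRHS]path_weight_cons.
apply: (le_trans _ (lerD (lexx _) (IH z _ pq))).
by rewrite /= !path_weight_cons addrA lerD2r sd.2.
Qed.

Lemma tour_weight_subseq d s t : semimetric d -> subseq s t ->
  tour_weight d s <= tour_weight d t.
Proof.
move=> sd; case: t => [/eqP->//|z t]; case: s => [_|a s].
  by rewrite [leLHS]/tour_weight big_nil tour_weight_cons path_weight_ge0.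
rewrite /=; case: eqVneq => [<-|_] st.
  by rewrite !tour_weight_cons path_weight_subseq.
(* If the first node [z] of the longer tour is dropped, put it back into the shorter one: this
   detours the closing edge through [z], and both tours then start alike. *)
apply: (@le_trans _ _ (tour_weight d (z :: a :: s))); last first.
  by rewrite !tour_weight_cons path_weight_subseq.
rewrite !tour_weight_cons rcons_cons path_weight_cons !path_weight_rcons.
by rewrite addrCA lerD2l addrC sd.2.
Qed.

Lemma doubled_euler_circuit_weight d T w : doubled_euler_circuit T w ->
  tour_weight d w = 2 * weight d T.
Proof.
move=> Tw; rewrite /tour_weight (perm_big _ Tw) big_cat /= !big_enum.
by rewrite -/(weight d T); lra.
Qed.

Lemma weight_set_seq_le d (es : seq {set V}) :
  (forall e, 0 <= d e) -> weight d [set e in es] <= \sum_(e <- es) d e.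
Proof.
move=> d0; elim: es => [|f es IH].
  by rewrite big_nil /weight big1 // => e; rewrite inE.
rewrite big_cons set_cons; apply: (le_trans _ (lerD (lexx _) IH)).
have [fes|nf] := boolP (f \in [set e in es]); last by rewrite /weight big_setU1.
by rewrite /weight (setUidPr _) ?sub1set // lerDr.
Qed.

(** * Extending the weights to loops *)

(* [c] is unconstrained outside edges; in particular loops, which shortcutting
   and collapsing produce, only get the expected weight 0 here. *)
Definition edge_weight c (e : {set V}) : R := if is_edge e then c e else 0.

Lemma edge_weightE c e : is_edge e -> edge_weight c e = c e.
Proof. by rewrite /edge_weight => ->. Qed.

Lemma edge_weight_ge0 c e : metric c -> 0 <= edge_weight c e.
Proof. by case=> c0 _; rewrite /edge_weight; case: ifP => // /c0. Qed.

Lemma edge_weight_semimetric c : metric c -> semimetric (edge_weight c).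
Proof.
move=> mc; have c0 x : edge_weight c [set x] = 0.
  by rewrite /edge_weight /is_edge cards1.
split=> // x y z.
have [->|xz] := eqVneq x z; first by rewrite setUid c0 addr_ge0 ?edge_weight_ge0.
have [<-|xy] := eqVneq x y; first by rewrite setUid c0 add0r.
have [<-|yz] := eqVneq y z; first by rewrite setUid c0 addr0.
by rewrite !edge_weightE ?is_edge_set2 //; apply: mc.2.
Qed.

Lemma weight_edge_weight c F : {in F, forall e, is_edge e} ->
  weight (edge_weight c) F = weight c F.
Proof. by move=> eF; apply: eq_bigr => e /eF; apply: edge_weightE. Qed.

Lemma path_weight_edge_weight c x p : uniq (x :: p) ->
  path_weight (edge_weight c) x p = path_weight c x p.
Proof.
elim: p x => [|y p IH] x; first by rewrite /path_weight !big_nil.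
case/andP; rewrite inE negb_or => /andP[xy _] /IH E.
by rewrite !path_weight_cons E edge_weightE ?is_edge_set2.
Qed.

(** On one node the closing edge is a loop, where the two weights may differ. *)
Lemma tour_weight_edge_weight c s : uniq s -> (1 < size s)%N ->
  tour_weight (edge_weight c) s = tour_weight c s.
Proof.
case: s => [|x [|y p]] // us _.
rewrite !tour_weight_cons !path_weight_rcons path_weight_edge_weight //.
rewrite edge_weightE // is_edge_set2.
by apply: contraTneq us => /= <-; rewrite mem_last.
Qed.

Lemma tour_weight_map d (f : V -> V) s :
  tour_weight d (map f s) = tour_weight (fun e => d (f @: e)) s.
Proof.
rewrite /tour_weight -(big_map (fun e : {set V} => f @: e) predT d).
congr (\sum_(e <- _) d e); case: s => // x p /=.
rewrite !closed_walk_edges_cons -map_rcons.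
elim: (rcons p x) {1 3}x => //= y q IH z.
by rewrite /path_edges /= -!/(path_edges _ _) IH imsetU !imset_set1.
Qed.

Lemma tour_weight_fixed d (f : V -> V) s : {in s, forall z, f z = z} ->
  tour_weight (fun e => d (f @: e)) s = tour_weight d s.
Proof. by move=> fs; rewrite -tour_weight_map map_id_in. Qed.

Lemma weight_setD1 d T e : e \in T -> weight d T = d e + weight d (T :\ e).
Proof. exact: big_setD1. Qed.

(** * Upper bounds on the weight of a minimum spanning tree *)

(** The edges in [es] contain a spanning tree; loops and repetitions in [es] only add nonnegative
    terms. *)
Lemma mst_le_connected c T (es : seq {set V}) :
  metric c -> min_spanning_tree c T -> connected_graph [set e in es] ->
  weight c T <= \sum_(e <- es) edge_weight c e.
Proof.
move=> mc [_ mT] /connected_edges ces.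
have c0 e := edge_weight_ge0 e mc.
have [|T' sT' TF] := connected_has_spanning_tree _ ces.
  by move=> e; rewrite inE => /andP[].
apply: le_trans (mT _ sT') _; rewrite -weight_edge_weight; last by case: sT'.
apply: (le_trans _ (weight_set_seq_le _ c0)).
have sub : T' \subset [set e in es].
  by apply: subset_trans TF _; apply/subsetP => e; rewrite inE => /andP[].
rewrite /weight [leRHS](big_setID T') /= (setIidPr sub) lerDl.
by apply: sumr_ge0.
Qed.

(** Replacing [[set x; y]] by [[set a; b]] in [T] reconnects the two components. *)
Lemma mst_exchange c T x y a b :
  metric c -> min_spanning_tree c T -> [set x; y] \in T ->
  a \in component (T :\ [set x; y]) x -> b \in component (T :\ [set x; y]) y ->
  c [set x; y] <= edge_weight c [set a; b].
Proof.
set F := T :\ _ => mc mT xyT; rewrite !inE => xa yb.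
have [eT cT _] := mT.1.
have := mst_le_connected (es := [set a; b] :: enum F) mc mT.
rewrite big_cons big_enum /= (weight_setD1 _ xyT).
rewrite -/(weight (edge_weight c) F) weight_edge_weight; last first.
  by move=> e /setD1P[_ /eT].
rewrite lerD2r; apply; set G := [set e in _].
have FG : F \subset G by apply/subsetP => e eF; rewrite inE in_cons mem_enum eF orbT.
apply: (connected_graph_from (x := x)) => z.
have [zx|/(component_cover cT)] := boolP (z \in component F x).
  by apply: connect_adjS FG _ _ _; rewrite inE in zx.
rewrite inE => /(connect_adjS FG) yz; apply: (connect_trans _ yz).
apply: connect_trans (connect_adjS FG xa) _.
apply: (connect_trans (y := b)); last by rewrite connect_adjC (connect_adjS FG).
by apply: connect1; rewrite /adj inE mem_head.
Qed.

Lemma mst_le_two_paths c T A a p a' p' u v :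
  metric c -> min_spanning_tree c T -> a :: p =i A -> a' :: p' =i ~: A ->
  u \in A -> v \notin A ->
  weight c T <= path_weight (edge_weight c) a p
    + path_weight (edge_weight c) a' p' + edge_weight c [set u; v].
Proof.
move=> mc mT pA pA' uA vA.
have := mst_le_connected
  (es := path_edges a p ++ path_edges a' p' ++ [:: [set u; v]]) mc mT.
rewrite !big_cat big_seq1 /= addrA; apply; set F := [set e in _].
have cp z : z \in A -> connect (adj F) a z.
  rewrite -pA; apply: connect_path_edges => e ep.
  by rewrite inE mem_cat ep.
have cp' z : z \notin A -> connect (adj F) a' z.
  rewrite -in_setC -pA'; apply: connect_path_edges => e ep.
  by rewrite inE !mem_cat ep orbT.
apply: (connected_graph_from (x := a)) => z.
have [/cp//|/cp' az] := boolP (z \in A).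
apply: (connect_trans _ az); apply: connect_trans (cp _ uA) _.
apply: (connect_trans (y := v)); last by rewrite connect_adjC cp'.
by apply: connect1; rewrite /adj inE !mem_cat mem_head !orbT.
Qed.

Lemma path_weight_le_tour c a p : metric c ->
  path_weight (edge_weight c) a p <= tour_weight (edge_weight c) (a :: p).
Proof.
by move=> mc; rewrite tour_weight_cons path_weight_rcons lerDl edge_weight_ge0.
Qed.

(** [A] can be either color class, so this serves whichever optimal tour crosses the cut. *)
Lemma mst_le_crossing_tours c T A (r b : seq V) x y u v :
  metric c -> min_spanning_tree c T -> max_weight_edge c T [set x; y] ->
  r =i A -> b =i ~: A -> b != [::] -> u \in r -> v \in r ->
  u \in component (T :\ [set x; y]) x -> v \notin component (T :\ [set x; y]) x ->
  weight c T <= tour_weight (edge_weight c) r + tour_weight (edge_weight c) b.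
Proof.
move=> mc mT [xyT emax] rA bA; case: b bA => // a' p' bA _ ur vr uL vL.
have [eT cT _] := mT.1.
have [k [a [p [E cross]]]] := crossing_rotation ur vr uL vL.
have a'A : a' \notin A by rewrite -in_setC -bA mem_head.
have uA : u \in A by rewrite -rA.
have [s [t [stT sA tA]]] := edge_leaving cT uA a'A.
have pA : a :: p =i A by move=> z; rewrite -E mem_rot rA.
apply: le_trans (mst_le_two_paths mc mT pA bA sA tA) _.
rewrite -(tour_weight_rot _ k) E tour_weight_cons path_weight_rcons.
(* It remains to pay for the tree edge [[set s; t]] between the classes with the closing edge of the
   rotated tour. That edge crosses the cut, so it weighs at least as much as [[set x; y]], the
   heaviest edge of [T]. *)
rewrite addrAC lerD ?path_weight_le_tour // lerD2l.
rewrite edge_weightE; last exact: eT.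
apply: le_trans (emax _ stT) _; move: cross.
have [lL|lL] := boolP (last a p \in _) => aL.
  apply: (mst_exchange mc mT) => //; apply: component_cover => //.
rewrite [[set last a p; a]]setUC; apply: (mst_exchange mc mT); rewrite ?component_cover //.
by apply: contraNT aL => /negPf->.
Qed.

(** * Colorings compatible with the cut *)

Lemma proper_coloringC P red : proper_coloring P red ->
  proper_coloring P (~: red).
Proof. by move=> pr A /pr[? ?]; rewrite setCK. Qed.

Lemma proper_coloring_card P red : partition P [set: V] ->
  proper_coloring P red -> #|red| = #|P|.
Proof.
move=> pP pr; rewrite -!sum1_card.
rewrite (eq_bigl (fun z => (z \in [set: V]) && (z \in red))); last first.
  by move=> z; rewrite in_setT.
rewrite (set_partition_big_cond _ pP); apply: eq_bigr => A /pr[AR _].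
by rewrite -[RHS]AR -sum1_card; apply: eq_bigl => z; rewrite inE.
Qed.

(** When one side of the cut is itself a color class, every pair is split by the cut, so no color is
    left to choose. *)
Lemma coloring_respects_component P T x y red :
  partition P [set: V] -> connected_graph T ->
  proper_coloring P (component (T :\ [set x; y]) x) ->
  coloring_respects P (component (T :\ [set x; y]) x)
    (component (T :\ [set x; y]) y) red ->
  forall z, (z \in red) = (z \notin component (T :\ [set x; y]) x).
Proof.
set L := component _ x => /and3P[/eqP cP _ _] cT pL resp z.
have : z \in cover P by rewrite cP in_setT.
case/bigcupP=> A AP zA; have [/eqP/cards1P[u uE] /eqP/cards1P[v vE]] := pL _ AP.
have AE : A = [set u; v] by rewrite -(setID A L) uE setDE vE.
have /setIP[_ uL] : u \in A :&: L by rewrite uE set11.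
have /setIP[_ ] : v \in A :&: ~: L by rewrite vE set11.
rewrite in_setC => vL.
have uvP : [set u; v] \in P by rewrite -AE.
have [ur vr] := resp u v uvP uL (component_cover cT vL).
move: zA; rewrite AE => /set2P[]->; first by rewrite uL (negPf ur).
by rewrite vL vr.
Qed.

(* Collapsing one side of the cut {x, y} to its endpoint turns the doubled tree
   into a doubled spanning tree of the other side. *)
Lemma split_tours_le d T w x y (sL sR : seq V) :
  let L := component (T :\ [set x; y]) x in
  semimetric d -> {in T, forall e, is_edge e} ->
  [set x; y] \in T -> y \notin L ->
  doubled_euler_circuit T w -> subseq sL w -> subseq sR w ->
  {subset sL <= L} -> {subset sR <= [predC L]} ->
  tour_weight d sL + tour_weight d sR <= 2 * weight d (T :\ [set x; y]).
Proof.
move=> L sd eT xyT yL Tw sLw sRw sLL sRR.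
have d0 := sd.1.
have xL : x \in L by rewrite inE connect0.
(* [f] collapses the complement of [L] to [x], and [g] collapses [L] to [y]; each fixes the tour on
   the other side. *)
pose f z := if z \in L then z else x; pose g z := if z \in L then y else z.
have fs : {in sL, forall z, f z = z} by move=> z /sLL zL; rewrite /f zL.
have gs : {in sR, forall z, g z = z}.
  by move=> z /sRR; rewrite inE /g => /negPf->.
rewrite -(tour_weight_fixed d fs) -(tour_weight_fixed d gs).
have lef := tour_weight_subseq (semimetric_imset f sd) sLw.
have leg := tour_weight_subseq (semimetric_imset g sd) sRw.
apply: le_trans (lerD lef leg) _.
rewrite !(doubled_euler_circuit_weight _ Tw) -mulrDr ler_wpM2l //.
(* Both collapses turn [[set x; y]] into a loop of weight 0. Any other tree edge lies on one side,
   so exactly one collapse preserves it and the other makes it a loop. *)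
rewrite !(weight_setD1 _ xyT) !imsetU !imset_set1 /f /g xL (negPf yL).
rewrite !setUid !d0 !add0r -big_split; apply: ler_sum => e eF.
have /eT/cards2P[a [b [_ E]]] : e \in T by case/setD1P: eF.
have ab : (a \in L) = (b \in L).
  rewrite !inE; apply: same_connect_r; first exact: (sym_connect_sym (@adj_sym _ _)).
  by apply: connect1; rewrite /adj -E.
rewrite E !imsetU !imset_set1 -/L -ab.
by case: ifP => _; rewrite /= setUid d0 ?addr0 ?add0r.
Qed.

End Weights.

(** * Feasibility of the output and the factor 4 *)

Theorem theorem5 (R : realFieldType) (V : finType) (n : nat)
    (P : {set {set V}}) (c : {set V} -> R)
    (inst : tsp2_instance n P c)
    (Cb Cr : seq V) (run : algorithm2 P c Cb Cr) :
  feasible P Cr Cb /\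
  (forall opt : R, is_min_sum_opt P c opt ->
     tour_weight c Cb + tour_weight c Cr <= 4 * opt).
Proof.
case: inst => oddn cardV [pP cardP] _ mc.
case: run => {Cb Cr} T x y red w mT emax pred resp Tw.
have [sT _] := mT; have [eT cT _] := sT; have xyT := emax.1.
(* [n] is even, and positive because the node [x] exists. So each color has at least two nodes and
   no tour uses a loop. *)
have n1 : (1 < n)%N.
  case: n oddn cardV {cardP} => [|[|n]] // _ V0.
  by have := max_card (pred1 x); rewrite V0 card1.
have color_size A s : proper_coloring P A -> tour_on A s -> (1 < size s)%N.
  move=> /(proper_coloring_card pP) cA [us sA].
  by rewrite -(card_uniqP us) (eq_card sA) cA cardP.
have wV z : z \in w.
  have [zx|zx] := eqVneq z x; last exact: doubled_euler_circuit_covers cT zx Tw.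
  apply: (doubled_euler_circuit_covers (y := y) cT _ Tw).
  by rewrite zx -is_edge_set2 eT.
set Cb := [seq v <- _ | v \notin _]; set Cr := [seq v <- _ | v \in _].
have tr : tour_on red Cr.
  split=> [|z]; first by rewrite filter_uniq ?shortcut_uniq.
  by rewrite mem_filter mem_shortcut wV andbT.
have tb : tour_on (~: red) Cb.
  split=> [|z]; first by rewrite filter_uniq ?shortcut_uniq.
  by rewrite mem_filter mem_shortcut wV andbT inE.
split=> [|opt [[r [b [[A [pA trA tbA]] <-]]] _]]; first by exists red.
have predC := proper_coloringC pred; have pAC := proper_coloringC pA.
have sm := edge_weight_semimetric mc.
have dE A' s : proper_coloring P A' -> tour_on A' s ->
    tour_weight c s = tour_weight (edge_weight c) s.
  by move=> pA' tA'; rewrite tour_weight_edge_weight ?tA'.1 ?(color_size A').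
rewrite (dE _ _ predC tb) (dE _ _ pred tr) (dE _ _ pA trA) (dE _ _ pAC tbA).
set d := edge_weight c.
have subb : subseq Cb w by apply: subseq_trans (filter_subseq _ _) (subseq_shortcut w).
have subr : subseq Cr w by apply: subseq_trans (filter_subseq _ _) (subseq_shortcut w).
have le4 : tour_weight d Cb + tour_weight d Cr <= 4 * weight c T.
  have hb := tour_weight_subseq sm subb; have hr := tour_weight_subseq sm subr.
  move: hb hr; rewrite (doubled_euler_circuit_weight _ Tw) weight_edge_weight //.
  by rewrite -/d; lra.
set L := component (T :\ [set x; y]) x.
have bn : b != [::] by case: (b) (color_size _ _ pAC tbA).
have rn : r != [::] by case: (r) (color_size _ _ pA trA).
(* Case 1: the optimal red tour visits both sides of the cut. *)
have [/hasP[u ur /andP[uL /hasP[v vr vL]]]|nr] :=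
    boolP (has (fun u => (u \in L) && has (fun v => v \notin L) r) r).
  have := mst_le_crossing_tours mc mT emax trA.2 tbA.2 bn ur vr uL vL.
  by rewrite -/d; lra.
(* Case 2: the optimal blue tour does, with the roles of [A] and its complement swapped. *)
have [/hasP[u ub /andP[uL /hasP[v vb vL]]]|nb] :=
    boolP (has (fun u => (u \in L) && has (fun v => v \notin L) b) b).
  have rA : r =i ~: ~: A by rewrite setCK; exact: trA.2.
  have := mst_le_crossing_tours mc mT emax tbA.2 rA rn ub vb uL vL.
  by rewrite -/d; lra.
have yL := tree_edge_separates sT xyT.
have xL : x \in L by rewrite inE connect0.
have same s u v : ~~ has (fun u => (u \in L) && has (fun v => v \notin L) s) s ->
    u \in s -> v \in s -> u \in L -> v \in L.
  move=> /hasPn h us vs uL; have := h _ us.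
  by rewrite uL => /hasPn/(_ _ vs); rewrite negbK.
have sameA u v : u \in A -> v \in A -> u \in L -> v \in L.
  by rewrite -!trA.2; apply: same.
have sameC u v : u \notin A -> v \notin A -> u \in L -> v \in L.
  by rewrite -!in_setC -!tbA.2; apply: same.
(* Case 3: each optimal class stays on one side. As [x] and [y] are on different sides, they have
   different colors, and the classes are the two sides. *)
have LA : (L = A) \/ (L = ~: A).
  have [xA|xA] := boolP (x \in A); [left|right]; apply/setP => z.
    have yA : y \notin A by apply: contra yL => yA; apply: sameA xA yA xL.
    apply/idP/idP => [zL|zA]; last exact: sameA xA zA xL.
    by apply: contraR yL => zA; apply: sameC zA yA zL.
  have yA : y \in A by apply: contraR yL => yA; apply: sameC xA yA xL.
  rewrite in_setC; apply/idP/idP => [zL|zA]; last exact: sameC xA zA xL.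
  by apply: contra yL => zA; apply: sameA zA yA zL.
have pL : proper_coloring P L by case: LA => ->.
have redE := coloring_respects_component pP cT pL resp.
have := split_tours_le sm eT xyT yL Tw subb subr.
have sL : {subset Cb <= L}.
  by move=> z; rewrite mem_filter redE negbK => /andP[].
have sR : {subset Cr <= [predC L]}.
  by move=> z; rewrite mem_filter redE => /andP[].
move=> /(_ sL sR); rewrite weight_edge_weight; last by move=> e /setD1P[_ /eT].
have xyA : exists u v, [/\ u \in A, v \notin A & [set u; v] = [set x; y]].
  case: LA => EL; move: xL yL; rewrite -/L EL ?in_setC ?negbK.
    by exists x, y.
  by exists y, x; rewrite setUC.
have [u [v [uA vA uvE]]] := xyA.
case: r b trA tbA rn bn {nr nb same} => [|a p] [|a' p'] // trA tbA _ _.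
(* Joining the optimal tours, opened to paths, by [[set x; y]] and cancelling its weight bounds the
   rest of the tree by the two paths. This gives factor 2 here; nonnegativity of the paths relaxes
   it to 4. *)
have := mst_le_two_paths mc mT trA.2 tbA.2 uA vA.
have := path_weight_le_tour a p mc; have := path_weight_le_tour a' p' mc.
have := path_weight_ge0 a p sm; have := path_weight_ge0 a' p' sm.
rewrite uvE (weight_setD1 _ xyT) edge_weightE ?eT // -/d.
by lra.
Qed.
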